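(* Let $\{\mathbb{X}_n\}_{n\in\mathbb{N}}$ be a sequence of non-trivial normed linear spaces over $\mathbb{K}$. The space $\bigoplus_0\mathbb{X}_n$ has no non-zero right-symmetric point. A point $x=\{x_n\}_{n\in\mathbb{N}}\in\bigoplus_0\mathbb{X}_n$ is left-symmetric if and only if there exists $n_0\in\mathbb{N}$ such that $x_n=0$ whenever $n\neq n_0$ and $x_{n_0}$ is a left-symmetric point of $\mathbb{X}_{n_0}$.
   Context: $\mathbb{K}=\mathbb{R}$ or $\mathbb{C}$; non-trivial means of dimension more than $0$. $\bigoplus_0\mathbb{X}_n$ is the space of sequences $\{x_n\}$ with $x_n\in\mathbb{X}_n$ and $\lim_n\|x_n\|=0$, with norm $\|\{x_n\}\|_0=\max_n\|x_n\|$. In a normed space $\mathbb{X}$, $x\perp_By$ means $\|x+\lambda y\|\ge\|x\|$ for every scalar $\lambda\in\mathbb{K}$. A point $x\in\mathbb{X}$ is left-symmetric if $x\perp_By\Rightarrow y\perp_Bx$ for every $y\in\mathbb{X}$, and right-symmetric if $y\perp_Bx\Rightarrow x\perp_By$ for every $y\in\mathbb{X}$. *)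

(* Defs.v *)
From HB Require Import structures.
From mathcomp Require Import all_boot all_order all_algebra.
From mathcomp Require Export complex.
From mathcomp Require Import boolp classical_sets reals topology normedtype.
Set Implicit Arguments.
Unset Strict Implicit.
Unset Printing Implicit Defensive.
Import Order.TTheory GRing.Theory Num.Theory.
Import numFieldNormedType.Exports.
Local Open Scope classical_set_scope.
Local Open Scope ring_scope.

Section BirkhoffJames.
Variables (K : numFieldType) (V : normedModType K).
Implicit Types x y : V.

(* The norm of a [normedModType K] takes its values in [K]. For [K = R[i]] the
   order of [K] is the partial order of [R[i]], which on the norms, that are
   nonnegative reals, is the order of [R]. *)
Definition BJ_orthogonal x y := forall l : K, `|x| <= `|x + l *: y|.

Definition left_symmetric_point x :=
  forall y, BJ_orthogonal x y -> BJ_orthogonal y x.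

Definition right_symmetric_point x :=
  forall y, BJ_orthogonal y x -> BJ_orthogonal x y.

Definition nontrivial_space := exists x, x != 0.

End BirkhoffJames.
Arguments nontrivial_space {K} V.

Section C0Sum.
Variables (K : numFieldType) (X : nat -> normedModType K).

Record c0sum := C0Sum {
  c0seq :> forall n, X n ;
  c0seq_cvg : (fun n => `|c0seq n|) @ \oo --> (0 : K) }.

HB.instance Definition _ := gen_eqMixin c0sum.
HB.instance Definition _ := gen_choiceMixin c0sum.

Lemma c0sumP (x y : c0sum) : (forall n, x n = y n) -> x = y.
Proof.
case: x y => [x hx] [y hy] /= xy.
have E : x = y by apply: functional_extensionality_dep.
by subst y; congr C0Sum; apply: Prop_irrelevance.
Qed.

Let cvg0P (u : nat -> K) :
  (forall e, 0 < e -> \forall n \near \oo, `|u n| < e) -> u @ \oo --> (0 : K).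
Proof.
move=> h; apply/cvgrPdist_lt => e e0; near=> n.
by rewrite sub0r normrN; near: n; exact: h.
Unshelve. all: by end_near. Qed.

Let cvg0E (x : c0sum) e : 0 < e -> \forall n \near \oo, `|x n| < e.
Proof.
move=> e0; move/cvgrPdist_lt: (c0seq_cvg x) => /(_ e e0) h; near=> n.
have : `|0 - `|x n| | < e by near: n.
by rewrite sub0r normrN normr_id.
Unshelve. all: by end_near. Qed.

Let c0zero_cvg : (fun n => `|0 : X n|) @ \oo --> (0 : K).
Proof. by apply: cvg0P => e e0; near=> n; rewrite !normr0.
Unshelve. all: by end_near. Qed.

Let c0opp_cvg (x : c0sum) : (fun n => `|- x n|) @ \oo --> (0 : K).
Proof.
apply: cvg0P => e e0; near=> n; rewrite normr_id normrN; near: n.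
exact: cvg0E.
Unshelve. all: by end_near. Qed.

Let c0add_cvg (x y : c0sum) : (fun n => `|x n + y n|) @ \oo --> (0 : K).
Proof.
apply: cvg0P => e e0; near=> n; rewrite normr_id.
apply: le_lt_trans (ler_normD _ _) _; rewrite (splitr e).
by apply: ltrD; near: n; apply: cvg0E; rewrite divr_gt0.
Unshelve. all: by end_near. Qed.

Let c0scale_cvg (a : K) (x : c0sum) :
  (fun n => `|a *: x n|) @ \oo --> (0 : K).
Proof.
have a1 : 0 < `|a| + 1 by rewrite ltr_wpDl.
apply: cvg0P => e e0; near=> n; rewrite normr_id normrZ.
apply: le_lt_trans (_ : _ <= (`|a| + 1) * `|x n|) _.
  by rewrite ler_wpM2r// lerDl.
rewrite mulrC -ltr_pdivlMr//; near: n.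
by apply: cvg0E; rewrite divr_gt0.
Unshelve. all: by end_near. Qed.

Definition c0zero := C0Sum c0zero_cvg.
Definition c0opp (x : c0sum) := C0Sum (c0opp_cvg x).
Definition c0add (x y : c0sum) := C0Sum (c0add_cvg x y).
Definition c0scale (a : K) (x : c0sum) := C0Sum (c0scale_cvg a x).

Let c0addA : associative c0add.
Proof. by move=> x y z; apply: c0sumP => n /=; rewrite addrA. Qed.
Let c0addC : commutative c0add.
Proof. by move=> x y; apply: c0sumP => n /=; rewrite addrC. Qed.
Let c0add0 : left_id c0zero c0add.
Proof. by move=> x; apply: c0sumP => n /=; rewrite add0r. Qed.
Let c0addN : left_inverse c0zero c0opp c0add.
Proof. by move=> x; apply: c0sumP => n /=; rewrite addNr. Qed.

HB.instance Definition _ :=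
  GRing.isZmodule.Build c0sum c0addA c0addC c0add0 c0addN.

Let c0scaleA a b x : c0scale a (c0scale b x) = c0scale (a * b) x.
Proof. by apply: c0sumP => n /=; rewrite scalerA. Qed.
Let c0scale1 : left_id 1 c0scale.
Proof. by move=> x; apply: c0sumP => n /=; rewrite scale1r. Qed.
Let c0scaleDr : right_distributive c0scale +%R.
Proof. by move=> a x y; apply: c0sumP => n /=; rewrite scalerDr. Qed.
Let c0scaleDl x : {morph c0scale^~ x : a b / a + b}.
Proof. by move=> a b; apply: c0sumP => n /=; rewrite scalerDl. Qed.

HB.instance Definition _ := GRing.Zmodule_isLmodule.Build K c0sum
  c0scaleA c0scale1 c0scaleDr c0scaleDl.

Lemma c0sum0E n : (0 : c0sum) n = 0.
Proof. by []. Qed.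
Lemma c0sumDE (x y : c0sum) n : (x + y) n = x n + y n.
Proof. by []. Qed.
Lemma c0sumNE (x : c0sum) n : (- x) n = - x n.
Proof. by []. Qed.
Lemma c0sumZE a (x : c0sum) n : (a *: x) n = a *: x n.
Proof. by []. Qed.

Definition is_max_norm (x : c0sum) (m : K) :=
  (exists n, `|x n| = m) /\ (forall n, `|x n| <= m).

(* The maximum of the norms of the terms; the default value [0] of [xget] is
   never used, by [c0norm_is_max]. *)
Definition c0norm (x : c0sum) : K := xget 0 (is_max_norm x).

Lemma c0norm_is_max (x : c0sum) : is_max_norm x (c0norm x).
Proof.
suff [n0 hn0] : exists n0, forall n, `|x n| <= `|x n0|.
  by apply: (@xgetPex _ 0 (is_max_norm x)); exists `|x n0|; split=> //; exists n0.
have [[k xk]|nx] := pselect (exists k, x k != 0); last first.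
  exists 0%N => n; have -> : x n = 0.
    by apply/eqP/negPn/negP => xn; apply: nx; exists n.
  by rewrite normr0.
have fin N : exists n0, forall n, (n <= N)%N -> `|x n| <= `|x n0|.
  elim: N => [|N [m hm]]; first by exists 0%N => n; rewrite leqn0 => /eqP ->.
  have /orP[h|h] : (`|x m| <= `|x N.+1|) || (`|x N.+1| <= `|x m|).
  - by apply: real_leVge; apply: normr_real.
  - exists N.+1 => n; rewrite leq_eqVlt ltnS => /orP[/eqP -> //|/hm].
    by move=> /le_trans; apply.
  - by exists m => n; rewrite leq_eqVlt ltnS => /orP[/eqP -> //|/hm].
have [N _ hN] : \forall n \near \oo, `|x n| < `|x k|.
  by apply: cvg0E; rewrite normr_gt0.
have [m hm] := fin (maxn N k); exists m => n.
have [nN|Nn] := leqP n (maxn N k); first exact: hm.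
apply: le_trans (hm k _); last by rewrite leq_maxr.
by apply/ltW/hN; rewrite /=; apply: leq_trans (ltnW Nn); rewrite leq_maxl.
Qed.

Let c0normD x y : c0norm (x + y) <= c0norm x + c0norm y.
Proof.
have [[n <-] _] := c0norm_is_max (x + y).
apply: le_trans (ler_normD _ _) _; apply: lerD.
  by case: (c0norm_is_max x) => _; apply.
by case: (c0norm_is_max y) => _; apply.
Qed.

Let c0normZ a x : c0norm (a *: x) = `|a| * c0norm x.
Proof.
have [[m em] um] := c0norm_is_max (a *: x).
have [[n en] un] := c0norm_is_max x.
apply/eqP; rewrite eq_le; apply/andP; split.
  by rewrite -em c0sumZE normrZ; apply: ler_wpM2l (un m).
by rewrite -en -normrZ -c0sumZE; apply: um.
Qed.

Let c0norm0_eq0 x : c0norm x = 0 -> x = 0.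
Proof.
move=> x0; have [_ ux] := c0norm_is_max x; apply: c0sumP => n.
by apply/eqP; rewrite c0sum0E -normr_le0; move: (ux n); rewrite x0.
Qed.

HB.instance Definition _ := Lmodule_isNormed.Build K c0sum
  c0normD c0normZ c0norm0_eq0.

Lemma c0sum_normE (x : c0sum) : `|x| = c0norm x.
Proof. by []. Qed.

End C0Sum.

(* Main.v *)
Require Import Defs.
From mathcomp Require Import all_boot all_order all_algebra.
From mathcomp Require Import boolp classical_sets reals topology normedtype.
Import Order.TTheory GRing.Theory Num.Theory.
Import numFieldNormedType.Exports.
Local Open Scope ring_scope.

(** Right symmetry: given [x != 0], choose [N] with [`|x N| < `|x|] and a unit
   vector [u] with [x N = `|x N| *: u], and let [y] be [x] with its [N]-th term
   replaced by [- `|x| *: u]. The terms of [y] at [N] and at an index where [x]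
   attains its norm pull in opposite directions along [x], so [y] is orthogonal
   to [x]; but [`|x - t *: y| < `|x|] for small [t > 0].

   Left symmetry: if [x] attains its norm at [i] and [x j != 0] with [j != i],
   then [x] is orthogonal to the sequence [y] concentrated at [j] with
   [y j = x j], whereas [`|y - t *: x| < `|y|] for small [t > 0]. If [x] is
   concentrated at [n0], orthogonality of [x] to [y] for small scalars only
   involves the term [n0], and convexity extends it to all scalars. *)

Section NormedModule.
Set Implicit Arguments.
Variables (K : numFieldType) (V : normedModType K).

Lemma BJ_orthogonal0r (x : V) : BJ_orthogonal x 0.
Proof. by move=> l; rewrite scaler0 addr0. Qed.

(** For [0 < t < 1] the point [x + (t * l) *: y] is a convex combination of [x] and [x + l *: y], so
    a bound at the small scalar [t * l] passes to [l]. *)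
Lemma BJ_orthogonal_local (x y : V) (d : K) : 0 < d ->
  (forall l, `|l| < d -> `|x| <= `|x + l *: y|) -> BJ_orthogonal x y.
Proof.
move=> d0 xy l.
pose t := d / (d + `|l|).
have dl0 : 0 < d + `|l| by rewrite ltr_wpDr.
have [->|l0] := eqVneq l 0; first by rewrite scale0r addr0.
have t0 : 0 < t by rewrite divr_gt0.
have t1 : t < 1 by rewrite ltr_pdivrMr// mul1r ltrDl normr_gt0.
have tl : `|t * l| < d.
  rewrite normrM gtr0_norm// /t mulrAC ltr_pdivrMr// ltr_pM2l//.
  by rewrite ltrDr.
clearbody t; have := xy _ tl.
have -> : x + (t * l) *: y = (1 - t) *: x + t *: (x + l *: y).
  by rewrite scalerDr scalerA addrA -scalerDl subrK scale1r.
move=> /le_trans /(_ (ler_normD _ _)).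
rewrite !normrZ (gtr0_norm t0) (@gtr0_norm _ (1 - t)) ?subr_gt0//.
by rewrite mulrBl mul1r -addrA lerDl addrC subr_ge0 ler_pM2l.
Qed.

Lemma unit_direction (x : V) : nontrivial_space V ->
  exists u : V, `|u| = 1 /\ x = `|x| *: u.
Proof.
move=> [v v0]; have unit (w : V) : w != 0 -> `| `|w|^-1 *: w| = 1.
  by move=> w0; rewrite normrZ normfV normr_id mulVf ?normr_eq0.
have [->|x0] := eqVneq x 0.
  by exists (`|v|^-1 *: v); rewrite normr0 scale0r unit.
by exists (`|x|^-1 *: x); rewrite unit// scalerA divff ?normr_eq0// scale1r.
Qed.

End NormedModule.

Section C0Sum.
Set Implicit Arguments.
Variables (K : numFieldType) (X : nat -> normedModType K).
Implicit Types x y : c0sum X.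

Lemma c0norm_attained x : exists n, `|x n| = `|x|.
Proof. by have [] := c0norm_is_max x. Qed.

Lemma le_c0norm x n : `|x n| <= `|x|.
Proof. by have [_] := c0norm_is_max x. Qed.

(** Strictness survives because the norm is a maximum, not just a supremum. *)
Lemma c0norm_lt x (m : K) : (forall n, `|x n| < m) -> `|x| < m.
Proof. by move=> xm; have [n <-] := c0norm_attained x. Qed.

Lemma c0sum_small_term x (e : K) : 0 < e -> exists n, `|x n| < e.
Proof.
move=> e0; have /cvgrPdist_lt/(_ e e0) [n _ xn] := c0seq_cvg x.
by exists n; have := xn n (leqnn n); rewrite sub0r normrN normr_id.
Qed.

Lemma c0sum_update x n (v : X n) :
  exists y, y n = v /\ forall k, k <> n -> y k = x k.
Proof.
pose f := dfwith (c0seq x) v.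
have fE k : k <> n -> f k = x k by move=> /eqP kn; rewrite /f dfwith_out// eq_sym.
have cvgf : ((fun k => `|f k|) @ \oo --> (0 : K))%classic.
  apply: cvg_trans (c0seq_cvg x); apply: near_eq_cvg.
  by exists n.+1 => // k /= nk; rewrite fE// => kn; rewrite kn ltnn in nk.
by exists (C0Sum cvgf); split => //=; rewrite /f dfwith_in.
Qed.

Lemma c0sum_single n (v : X n) :
  exists y : c0sum X, y n = v /\ forall k, k <> n -> y k = 0.
Proof. exact: (@c0sum_update 0 n v). Qed.

Lemma c0norm_single x n : (forall k, k <> n -> x k = 0) -> `|x| = `|x n|.
Proof.
move=> x0; apply/eqP; rewrite eq_le le_c0norm andbT.
have [k <-] := c0norm_attained x.
by have [->//|/eqP/x0 ->] := eqVneq k n; rewrite normr0.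
Qed.

Lemma right_symmetric_c0sum_eq0 x : (forall n, nontrivial_space (X n)) ->
  right_symmetric_point x -> x = 0.
Proof.
move=> hX rx; apply/eqP/negPn/negP => x0.
have m0 : 0 < `|x| by rewrite normr_gt0.
(* The bound [|x| / 2] keeps [N] apart from any index attaining the norm and leaves room at [N] for
   a perturbation by a quarter of [y]. *)
have [N xN] : exists n, `|x n| < `|x| / 2.
  by apply: c0sum_small_term; rewrite divr_gt0.
have [u [u1 xu]] := unit_direction (x N) (hX N).
have [y [yN yx]] := c0sum_update x N (- `|x| *: u).
have yNnorm : `|y N| = `|x| by rewrite yN normrZ u1 mulr1 normrN normr_id.
have ynorm : `|y| = `|x|.
  apply/eqP; rewrite eq_le -{2}yNnorm le_c0norm andbT.
  have [k <-] := c0norm_attained y.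
  by have [->|/eqP/yx ->] := eqVneq k N; rewrite ?yNnorm// le_c0norm.
have [k xk] := c0norm_attained x.
have kN : k <> N.
  move=> kN; move: xN; rewrite -kN xk ltr_pdivlMr// gtr_pMr// => /lt_trans.
  by move=> /(_ 2 (ltr1n _ 2)); rewrite ltxx.
have yperp : BJ_orthogonal y x.
  move=> l; rewrite ynorm.
  (* The term at [k] is [(1 + l) *: x k]. If it is too short, then [|1 + l| < 1], and the term at
     [N] is long enough. *)
  have [|lk] := real_leP (normr_real x) (normr_real ((y + l *: x) k)).
    by move=> /le_trans; apply; apply: le_c0norm.
  apply: le_trans (le_c0norm _ N).
  have := lk; rewrite c0sumDE c0sumZE (yx _ kN) -{1}[x k]scale1r -scalerDl.
  rewrite normrZ xk gtr_pMl// => l1.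
  have -> : (y + l *: x) N = (l * `|x N| - `|x|) *: u.
    by rewrite c0sumDE c0sumZE yN {1}xu scalerA addrC -scalerDl.
  rewrite normrZ u1 mulr1.
  (* [(1 + l) * `|x N|] and [`|x| - l * `|x N|] add up to [`|x N| + `|x|]. *)
  have : `|x N| + `|x| <= `|1 + l| * `|x N| + `|l * `|x N| - `|x| |.
    have -> : `|1 + l| * `|x N| = `|(1 + l) * `|x N| |.
      by rewrite normrM normr_id.
    apply: le_trans (ler_normB _ _).
    rewrite opprB mulrDl mul1r -addrA subrKC.
    by rewrite ger0_norm// addr_ge0.
  move=> sum; rewrite -(lerD2l `|x N|); apply: le_trans sum _.
  by rewrite lerD2r ler_piMl// ltW.
(* With [t = 1/4], the term at [N] is at most [|x N| + |x| / 4], and every other term shrinks by the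
   factor [3/4]. *)
have := rx y yperp (- 4^-1); apply/negP.
rewrite -real_ltNge ?normr_real//; apply: c0norm_lt => n.
have q0 : 0 < 4^-1 :> K by rewrite invr_gt0.
rewrite c0sumDE c0sumZE; have [->|/eqP/yx ->] := eqVneq n N.
  apply: le_lt_trans (ler_normD _ _) _.
  rewrite normrZ yNnorm normrN gtr0_norm// [ltRHS]splitr.
  by rewrite ltr_leD// mulrC ler_pM2l// lef_pV2 ?posrE// ler_nat.
rewrite -{1}[x n]scale1r -scalerDl normrZ.
have q1 : 4^-1 < 1 :> K by rewrite invf_lt1// ltr1n.
rewrite (@gtr0_norm _ (1 - _)) ?subr_gt0//.
apply: le_lt_trans (_ : (1 - 4^-1) * `|x| < _).
  by rewrite ler_wpM2l ?le_c0norm// subr_ge0 ltW.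
by rewrite gtr_pMl// gtrDl oppr_lt0.
Qed.

Lemma left_symmetric_c0sum_supp x i : left_symmetric_point x ->
  `|x i| = `|x| -> forall j, j <> i -> x j = 0.
Proof.
move=> lx xi j ji; apply/eqP/negPn/negP => xj.
have [y [yj y0]] := c0sum_single j (x j).
have xperp : BJ_orthogonal x y.
  move=> l; rewrite -xi; apply: le_trans (le_c0norm _ i).
  by rewrite c0sumDE c0sumZE y0 ?scaler0 ?addr0// => /esym.
have xj0 : 0 < `|x j| by rewrite normr_gt0.
have m0 : 0 < `|x| := lt_le_trans xj0 (le_c0norm x j).
(* This [t] gives [t * |x| = |x j| / 2], so the terms of [y - t *: x] away from [j] stay below
   [|x j|]; as [t < 1], the term at [j] shrinks. *)
pose t := `|x j| / (2 * `|x|).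
have tm0 : 0 < 2 * `|x| by rewrite mulr_gt0.
have t0 : 0 < t by rewrite divr_gt0.
have tx : t * `|x| < `|x j|.
  by rewrite /t mulrAC ltr_pdivrMr// ltr_pM2l// ltr_pMl// ltr1n.
have t1 : t < 1.
  rewrite ltr_pdivrMr// mul1r; apply: le_lt_trans (le_c0norm x j) _.
  by rewrite ltr_pMl// ltr1n.
have := lx y xperp (- t); apply/negP.
rewrite -real_ltNge ?normr_real// (c0norm_single _ y0) yj.
apply: c0norm_lt => n; rewrite c0sumDE c0sumZE.
have [->|/eqP/y0 ->] := eqVneq n j.
  rewrite yj -{1}[x j]scale1r -scalerDl normrZ gtr_pMl//.
  by rewrite (@gtr0_norm _ (1 - t)) ?subr_gt0// gtrDl oppr_lt0.
rewrite add0r normrZ normrN gtr0_norm//; apply: le_lt_trans tx.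
by rewrite ler_pM2l// le_c0norm.
Qed.

(** The sequences concentrated at [n] form an isometric copy of [X n]. *)
Lemma left_symmetric_c0sum_term x n : (forall k, k <> n -> x k = 0) ->
  left_symmetric_point x -> left_symmetric_point (x n).
Proof.
move=> x0 lx v xv; have [y [yn y0]] := c0sum_single n v.
have xy : BJ_orthogonal x y.
  move=> l; rewrite (c0norm_single _ x0); apply: le_trans (le_c0norm _ n).
  by rewrite c0sumDE c0sumZE yn.
move=> l; have := lx y xy l.
rewrite (c0norm_single _ y0) yn (@c0norm_single (y + l *: x) n).
  by rewrite c0sumDE c0sumZE yn.
by move=> k kn; rewrite c0sumDE c0sumZE y0// x0// scaler0 addr0.
Qed.

Lemma left_symmetric_c0sum_single x n : (forall k, k <> n -> x k = 0) ->
  left_symmetric_point (x n) -> left_symmetric_point x.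
Proof.
move=> x0 lx y xy; have xE := c0norm_single _ x0.
have [xn0|xn0] := eqVneq (x n) 0.
  have -> : x = 0 by apply/eqP; rewrite -normr_eq0 xE xn0 normr0.
  exact: BJ_orthogonal0r.
have y1 : 0 < `|y| + 1 by rewrite ltr_wpDl.
have xnyn : BJ_orthogonal (x n) (y n).
  (* Within this radius every term [l *: y k] with [k <> n] is shorter than [x n], so [x + l *: y]
     attains its norm at [n]. The [+ 1] avoids division by zero. *)
  apply: (@BJ_orthogonal_local _ _ _ _ (`|x n| / (`|y| + 1))).
    by rewrite divr_gt0 ?normr_gt0.
  move=> l; rewrite ltr_pdivlMr// => ly.
  have := xy l; rewrite xE.
  have [k <-] := c0norm_attained (x + l *: y).
  have [->|/eqP/x0 xk] := eqVneq k n; first by rewrite c0sumDE c0sumZE.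
  rewrite c0sumDE c0sumZE xk add0r normrZ => /le_lt_trans.
  suff /[swap]/[apply] : `|l| * `|y k| < `|x n| by rewrite ltxx.
  apply: le_lt_trans ly; rewrite ler_wpM2l//.
  by apply: le_trans (le_c0norm y k) _; rewrite lerDl.
(* Where [y] attains its norm, either [k <> n] and adding [l *: x] changes nothing, or [k = n] and
   left symmetry of [x n] applies. *)
move=> l; have [k <-] := c0norm_attained y.
apply: le_trans (le_c0norm _ k); rewrite c0sumDE c0sumZE.
have [->|/eqP/x0 ->] := eqVneq k n; first exact: lx.
by rewrite scaler0 addr0.
Qed.

End C0Sum.

Theorem theorem24 (R : realType) (K : numFieldType)
  (hK : K = R :> numFieldType \/ K = R[i] :> numFieldType)
  (X : nat -> normedModType K)
  (hX : forall n, nontrivial_space (X n)) :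
  ~ (exists x : c0sum X, x != 0 /\ right_symmetric_point x) /\
  (forall x : c0sum X,
     left_symmetric_point x <->
     exists n0 : nat,
       (forall n : nat, n <> n0 -> x n = 0) /\ left_symmetric_point (x n0)).
Proof.
split=> [[x [/eqP x0 /right_symmetric_c0sum_eq0]]|x]; first by move=> /(_ hX).
split=> [lx|[n [x0 lx]]]; last exact: left_symmetric_c0sum_single x0 lx.
(* Any index attaining the norm serves as [n0], also for [x = 0]. *)
have [i xi] := c0norm_attained x.
have x0 := left_symmetric_c0sum_supp lx xi.
by exists i; split=> //; apply: left_symmetric_c0sum_term x0 lx.
Qed.
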